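(* Let $\mathcal{A}$ be an algebra and let $f:\mathcal{A} \to \mathcal{A}$ be a $(g_1, h_1, g_2, h_2)$-derivation, that is, $f, g_1, g_2, h_1, h_2:\mathcal{A}\to\mathcal{A}$ are mappings with $f$ additive and $f(ab) = g_1(a) h_1(b) + g_2(a) h_2(b)$ for all $a, b \in \mathcal{A}$. Set $\mathfrak{X}_1 = g_1(a) h_1(b)$ and $\mathfrak{X}_2 = g_2(a) h_2(b)$. Then, for each $n \in \mathbb{N}$ and $a, b \in \mathcal{A}$, we have $$f^{n}(ab) = (\mathfrak{X}_1 + \mathfrak{X}_2)^{n} = \sum_{k = 0}^{n}\binom{n}{k}\,\delta_{\mathfrak{X}_1 + \mathfrak{X}_2,\, \mathfrak{X}_2}^{\,n - k}\big(\mathbf{1}_{(a,b)}^{\otimes}\big) \otimes \mathfrak{X}_2^{k} = \sum_{k = 0}^{n}\sum_{j = 0}^{n - k}\binom{n}{k}\binom{n-k}{j}(-1)^{j}(\mathfrak{X}_1 + \mathfrak{X}_2)^{n - k - j}\otimes \mathfrak{X}_2^{j + k},$$ where $\delta_{\mathfrak{X}_1 + \mathfrak{X}_2, \mathfrak{X}_2}^{0}= g_1^{0} = g_2^0 = h_1^0 = h_2^{0} = I$. Here the powers of $\mathfrak{X}_1+\mathfrak{X}_2$ and $\mathfrak{X}_2$ are taken with respect to the operation $\otimes$.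
   Context: $I$ is the identity mapping; $TS$ denotes the composition of mappings $T,S:\mathcal{A}\to\mathcal{A}$, and $f^n$ is the $n$-fold composition of $f$. The operation $\otimes$: let $a,b\in\mathcal{A}$. For mappings $T_1,T_2,S_1,S_2:\mathcal{A}\to\mathcal{A}$, the operation $\otimes$ between the elements $T_1(a)S_1(b)$ and $T_2(a)S_2(b)$ is defined by $$\big(T_1(a)S_1(b)\big)\otimes\big(T_2(a)S_2(b)\big) = T_1T_2(a)\,S_1S_2(b).$$ For $\mathfrak{Z}_i = T_i(a)S_i(b)$, $i\in\{1,2,3\}$, it is assumed that $\otimes$ is distributive, i.e. $(\mathfrak{Z}_1+\mathfrak{Z}_2)\otimes\mathfrak{Z}_3 = \mathfrak{Z}_1\otimes\mathfrak{Z}_3+\mathfrak{Z}_2\otimes\mathfrak{Z}_3$ and $\mathfrak{Z}_1\otimes(\mathfrak{Z}_2+\mathfrak{Z}_3) = \mathfrak{Z}_1\otimes\mathfrak{Z}_2+\mathfrak{Z}_1\otimes\mathfrak{Z}_3$; moreover $\mathfrak{Z}_i\otimes(\mathfrak{Z}_j\otimes\mathfrak{Z}_k) = (\mathfrak{Z}_i\otimes\mathfrak{Z}_j)\otimes\mathfrak{Z}_k$. The identity element with respect to $\otimes$ is $\mathbf{1}_{(a,b)}^{\otimes} = I(a)I(b) = ab$. In particular $\mathfrak{X}_1\otimes\mathfrak{X}_2 = g_1g_2(a)\,h_1h_2(b)$, $\mathfrak{X}_i^{n} = \mathfrak{X}_i\otimes\cdots\otimes\mathfrak{X}_i$ ($n$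 times) $= g_i^n(a)h_i^n(b)$, and $\mathfrak{X}_i^0=\mathbf{1}_{(a,b)}^{\otimes}$ for $i\in\{1,2\}$. The map $\delta$: for elements $b_1,b_2$, $\delta_{b_1,b_2}$ is the inner generalized derivation $\delta_{b_1,b_2}(x) = b_1x - xb_2$; here the product used is $\otimes$, so $\delta_{\mathfrak{X}_1+\mathfrak{X}_2,\mathfrak{X}_2}(x) = (\mathfrak{X}_1+\mathfrak{X}_2)\otimes x - x\otimes\mathfrak{X}_2$, and $\delta^m$ is the $m$-fold composition. *)

(* Defs.v *)
From HB Require Import structures.
From mathcomp Require Import all_boot all_order all_algebra.
From mathcomp Require Import finmap boolp.
From mathcomp.multinomials Require Import monalg.

Set Implicit Arguments.
Unset Strict Implicit.
Unset Printing Implicit Defensive.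

Import GRing.Theory.
Local Open Scope fset_scope.
Local Open Scope ring_scope.

(* The operation (x) is not well defined on the values T(a)S(b), which do not
   determine the mappings T and S, so it is defined on formal expressions.
   [tensor A] is the ring of formal integer combinations of symbols T(a)S(b),
   indexed by the pair (T, S): the integral monoid ring of End(A) x End(A),
   where End(A) is the monoid of all (set-theoretic) maps A -> A under
   composition.  Its product is (x); [teval] below gives the value in A of a
   formal expression at actual elements a and b.  The monoid-algebra product
   of multinomials does not apply, since its monomials have no nontrivial
   factorization of 1, whereas maps may be invertible. *)
Definition tensor (A : choiceType) : Type :=
  {malg int[((A -> A) * (A -> A))%type]}.

HB.instance Definition _ (A : choiceType) :=
  GRing.Zmodule.copy (tensor A) {malg int[((A -> A) * (A -> A))%type]}.

(* The symbol T(a)S(b), with a and b left as placeholders. *)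
Definition tterm (A : choiceType) (T S : A -> A) : tensor A :=
  << 1 *g (T, S) >>.

Section TensorRing.
Variable A : choiceType.
Local Notation K := ((A -> A) * (A -> A))%type.
Implicit Types (z : tensor A) (u v w : K).

Definition pcomp u v : K := (u.1 \o v.1, u.2 \o v.2).
Definition tone : tensor A := tterm id id.
Definition tmul z1 z2 : tensor A :=
  \sum_(u <- msupp z1) \sum_(v <- msupp z2) << z1@_u * z2@_v *g pcomp u v >>.

Lemma tmulw (d1 d2 : {fset K}) z1 z2 :
    msupp z1 `<=` d1 -> msupp z2 `<=` d2 ->
  tmul z1 z2 =
  \sum_(u <- d1) \sum_(v <- d2) << z1@_u * z2@_v *g pcomp u v >>.
Proof.
move=> le1 le2; rewrite /tmul.
rewrite (big_fset_incl _ le1) /=; last first.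
  move=> u _ /mcoeff_outdom z1u; rewrite big1 // => v _.
  by rewrite z1u mul0r monalgU0.
apply: eq_bigr => u _; apply: big_fset_incl => // v _ /mcoeff_outdom ->.
by rewrite mulr0 monalgU0.
Qed.

Lemma tmulUU c1 c2 u v :
  tmul << c1 *g u >> << c2 *g v >> = << c1 * c2 *g pcomp u v >>.
Proof. by rewrite (tmulw msuppU_le msuppU_le) !big_seq_fset1 !mcoeffUU. Qed.

Lemma tmulDl : left_distributive tmul +%R.
Proof.
move=> x y z; have sub := fsubset_refl (msupp z).
rewrite (tmulw (msuppD_le x y) sub) (tmulw (fsubsetUl _ (msupp y)) sub).
rewrite (tmulw (fsubsetUr (msupp x) _) sub) -big_split; apply: eq_bigr => u _.
by rewrite -big_split; apply: eq_bigr => v _; rewrite mcoeffD mulrDl monalgUD.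
Qed.

Lemma tmulDr : right_distributive tmul +%R.
Proof.
move=> z x y; have sub := fsubset_refl (msupp z).
rewrite (tmulw sub (msuppD_le x y)) (tmulw sub (fsubsetUl _ (msupp y))).
rewrite (tmulw sub (fsubsetUr (msupp x) _)) -big_split; apply: eq_bigr => u _.
by rewrite -big_split; apply: eq_bigr => v _; rewrite mcoeffD mulrDr monalgUD.
Qed.

Lemma tmul0l : left_zero 0 tmul.
Proof. by move=> z; rewrite /tmul msupp0 big_seq_fset0. Qed.

Lemma tmul0r : right_zero 0 tmul.
Proof.
by move=> z; rewrite /tmul big1 // => u _; rewrite msupp0 big_seq_fset0.
Qed.

Lemma tensor_ind (P : tensor A -> Prop) :
    P 0 -> (forall x y, P x -> P y -> P (x + y)) ->
    (forall c u, P << c *g u >>) -> forall z, P z.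
Proof. by move=> P0 PD PU z; rewrite [z]monalgE; apply: big_ind. Qed.

Lemma tmul1l : left_id tone tmul.
Proof.
elim/tensor_ind => [|x y Hx Hy|c [T S]]; first exact: tmul0r.
  by rewrite tmulDr Hx Hy.
by rewrite tmulUU mul1r.
Qed.

Lemma tmul1r : right_id tone tmul.
Proof.
elim/tensor_ind => [|x y Hx Hy|c [T S]]; first exact: tmul0l.
  by rewrite tmulDl Hx Hy.
by rewrite tmulUU mulr1.
Qed.

Lemma tmulA : associative tmul.
Proof.
elim/tensor_ind => [y z|x1 x2 H1 H2 y z|c u]; first by rewrite !tmul0l.
  by rewrite !tmulDl H1 H2.
elim/tensor_ind => [z|y1 y2 H1 H2 z|d v].
- by rewrite tmul0l tmul0r tmul0l.
- by rewrite tmulDl !tmulDr tmulDl H1 H2.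
elim/tensor_ind => [|z1 z2 H1 H2|e w]; first by rewrite !tmul0r.
  by rewrite !tmulDr H1 H2.
by rewrite !tmulUU mulrA.
Qed.

Lemma tone_neq0 : tone != 0.
Proof. by rewrite monalgU_eq0 oner_eq0. Qed.

HB.instance Definition _ := GRing.Zmodule_isNzRing.Build (tensor A)
  tmulA tmul1l tmul1r tmulDl tmulDr tone_neq0.

Lemma tterm1 : tterm id id = 1 :> tensor A.
Proof. by []. Qed.

Lemma ttermM (T1 S1 T2 S2 : A -> A) :
  tterm T1 S1 * tterm T2 S2 = tterm (T1 \o T2) (S1 \o S2).
Proof. exact: tmulUU. Qed.

End TensorRing.

Definition teval (A : zmodType) (mul : A -> A -> A) (a b : A) (z : tensor A)
  : A := \sum_(u <- msupp z) mul (u.1 a) (u.2 b) *~ z@_u.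

Section TensorEval.
Variables (A : zmodType) (mul : A -> A -> A) (a b : A).

Lemma tevalw (d : {fset (A -> A) * (A -> A)}) (z : tensor A) :
  msupp z `<=` d -> teval mul a b z = \sum_(u <- d) mul (u.1 a) (u.2 b) *~ z@_u.
Proof.
move=> le; apply: big_fset_incl => // u _ /mcoeff_outdom ->.
by rewrite mulr0z.
Qed.

Lemma tevalD (x y : tensor A) :
  teval mul a b (x + y) = teval mul a b x + teval mul a b y.
Proof.
rewrite (tevalw (msuppD_le x y)) (tevalw (fsubsetUl _ (msupp y))).
rewrite (tevalw (fsubsetUr (msupp x) _)) -big_split; apply: eq_bigr => u _.
by rewrite mcoeffD mulrzDr.
Qed.

Lemma teval_term (T S : A -> A) : teval mul a b (tterm T S) = mul (T a) (S b).
Proof. by rewrite (tevalw msuppU_le) big_seq_fset1 mcoeffUU. Qed.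

End TensorEval.

Definition is_gh_derivation (A : zmodType) (mul : A -> A -> A)
    (g1 h1 g2 h2 f : A -> A) : Prop :=
  {morph f : x y / x + y} /\
  forall a b, f (mul a b) = mul (g1 a) (h1 b) + mul (g2 a) (h2 b).

Definition inner_gder (B : nzRingType) (b1 b2 x : B) : B := b1 * x - x * b2.

(* Main.v *)
(* Left multiplication by X1 + X2 is the sum of the generalized derivation
   D = delta_(X1 + X2, X2) and of right multiplication by X2, and D itself is
   left multiplication by X1 + X2 minus right multiplication by X2.  In both
   decompositions the two summands commute, so that Pascal's rule expands the
   powers of left multiplication, resp. of D, at the identity.  The value in A
   is reached because applying f to an evaluated expression amounts to
   multiplying the expression by X1 + X2 on the left. *)
Require Import Defs.
From HB Require Import structures.
From mathcomp Require Import all_boot all_order all_algebra.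
From mathcomp.multinomials Require Import monalg.
Import GRing.Theory.
Local Open Scope ring_scope.

(** Think of [u m k] as P^m Q^k applied to a fixed vector, with P, Q commuting and L = P + Q. Each
    application of [L] splits every term in two, and Pascal's rule regroups them. *)
Lemma iter_additive_pascal (V : zmodType) (L : {additive V -> V})
    (u : nat -> nat -> V) (n : nat) :
    (forall m k, L (u m k) = u m.+1 k + u m k.+1) ->
  iter n L (u 0 0) = \sum_(k < n.+1) u (n - k)%N k *+ 'C(n, k).
Proof.
move=> Lu; elim: n => [|n IHn]; first by rewrite big_ord1 bin0 mulr1n.
rewrite iterS IHn raddf_sum [RHS]big_ord_recl.
under [in RHS]eq_bigr => k _ do rewrite lift0 binS mulrnDr subSS.
rewrite big_split /= addrA.
under eq_bigr => k _ do rewrite raddfMn Lu mulrnDl -subSn -1?ltnS //.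
rewrite big_split /=; congr (_ + _).
(* The extra last term on the right vanishes because 'C(n, n+1) = 0. *)
by rewrite big_ord_recl [in RHS]big_ord_recr /= (bin_small (ltnSn n)) addr0 !bin0.
Qed.

Section InnerGeneralizedDerivation.
Variables (B : nzRingType) (b1 b2 : B).

Fact inner_gder_is_zmod_morphism : zmod_morphism (inner_gder b1 b2).
Proof.
by move=> x y; rewrite /inner_gder mulrBr mulrBl !opprB addrACA [RHS]addrACA
  [- _ + _]addrC.
Qed.

HB.instance Definition _ := GRing.isZmodMorphism.Build B B (inner_gder b1 b2)
  inner_gder_is_zmod_morphism.

Lemma expr_inner_gder n :
  b1 ^+ n =
    \sum_(k < n.+1) (iter (n - k) (inner_gder b1 b2) 1 * b2 ^+ k) *+ 'C(n, k).
Proof.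
pose u m k := iter m (inner_gder b1 b2) 1 * b2 ^+ k.
(* [b1 \*o idfun] is left multiplication by [b1], in a form known to be additive. *)
rewrite -(@iter_additive_pascal B (b1 \*o idfun) u) => [|m k].
  by rewrite [u 0 0]mulr1 (@eq_iter _ _ ( *%R b1)) ?iter_mulr_1.
by rewrite /u /= /inner_gder mulrBl exprS !mulrA subrK.
Qed.

Lemma iter_inner_gder1 n :
  iter n (inner_gder b1 b2) 1 =
    \sum_(j < n.+1) (b1 ^+ (n - j) * b2 ^+ j) *~ ('C(n, j)%:Z * (-1) ^+ j).
Proof.
(* Absorbing the sign into [u] turns the difference defining [inner_gder] into the sum required by
   Pascal's rule. *)
pose u m k := (b1 ^+ m * b2 ^+ k) *~ (-1) ^+ k.
have u00 : u 0 0 = 1 by rewrite /u mulr1.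
rewrite -u00 (@iter_additive_pascal B (inner_gder b1 b2) u) => [|m k].
  by apply: eq_bigr => j _; rewrite pmulrn -mulrzA [X in _ *~ X]mulrC.
rewrite /u raddfMz /inner_gder mulrzBl -[_ * b2]mulrA -exprSr mulrA -exprS.
by rewrite [(-1) ^+ k.+1]exprS mulN1r mulrNz.
Qed.

End InnerGeneralizedDerivation.

(** On a single symbol this is the derivation rule; it extends to all expressions because their
    coefficients are integers, which commute with any additive map. *)
Lemma gh_derivation_teval {A : zmodType} {mul : A -> A -> A}
    {f g1 h1 g2 h2 : A -> A} (a b : A) (z : tensor A) :
    is_gh_derivation mul g1 h1 g2 h2 f ->
  f (teval mul a b z) = teval mul a b ((tterm g1 h1 + tterm g2 h2) * z).
Proof.
case=> fD fM.
have f0 : f 0 = 0 by apply: (addrI (f 0)); rewrite -fD !addr0.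
pose fA : {additive A -> A} :=
  HB.pack f (GRing.isNmodMorphism.Build A A f (conj f0 fD)).
have tevalU c u : teval mul a b << c *g u >> = mul (u.1 a) (u.2 b) *~ c.
  by rewrite (tevalw _ _ _ msuppU_le) finmap.big_seq_fset1 mcoeffUU.
have teval0 : teval mul a b 0 = 0.
  by rewrite /teval msupp0 finmap.big_seq_fset0.
elim/tensor_ind: z => [|x y IHx IHy|c [T S]].
- by rewrite mulr0 teval0.
- by rewrite mulrDr !tevalD fD IHx IHy.
rewrite mulrDl tevalD [tterm g1 h1 * _]tmulUU [tterm g2 h2 * _]tmulUU.
by rewrite !tevalU !mul1r -[f _]/(fA _) raddfMz /= fM mulrzDl.
Qed.

Theorem theorem3p4 (R : comNzRingType) (A : lmodType R)
    (mul : {bilinear A -> A -> A}) (mulA : associative mul)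
    (f g1 h1 g2 h2 : A -> A)
    (hf : is_gh_derivation mul g1 h1 g2 h2 f) (n : nat) (a b : A) :
  let X1 : tensor A := tterm g1 h1 in
  let X2 : tensor A := tterm g2 h2 in
  [/\ iter n f (mul a b) = teval mul a b ((X1 + X2) ^+ n),
      (X1 + X2) ^+ n =
        \sum_(k < n.+1)
          (iter (n - k) (inner_gder (X1 + X2) X2) 1 * X2 ^+ k) *+ 'C(n, k)
    & (X1 + X2) ^+ n =
        \sum_(k < n.+1) \sum_(j < (n - k).+1)
          ((X1 + X2) ^+ (n - k - j) * X2 ^+ (j + k))
            *~ (('C(n, k) * 'C(n - k, j))%:Z * (-1) ^+ j)].
Proof.
move=> X1 X2; split.
- elim: n => [|n IHn]; first by rewrite expr0 -tterm1 teval_term.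
  by rewrite iterS IHn (gh_derivation_teval _ _ _ hf) -exprS.
- exact: expr_inner_gder.
(* Only the power on the left is expanded; the powers of D at 1 are then expanded term by term. *)
rewrite {1}(expr_inner_gder _ _ X2); apply: eq_bigr => k _.
rewrite iter_inner_gder1 mulr_suml -sumrMnl; apply: eq_bigr => j _.
rewrite mulrzAl -mulrA -exprD pmulrn -mulrzA; congr (_ *~ _).
by rewrite PoszM mulrC mulrA.
Qed.
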